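(* Let $(X,q)$ be a right-bounded asymmetric normed space, let $\theta_q=\{x\in X:q(x)=0\}$ and let $\langle\theta_q\rangle$ be its linear span. Suppose that (1) $\langle\theta_q\rangle$ is closed in the normed space $(X,q^s)$, and (2) there exists a norm $\|\cdot\|$ on $X$ equivalent to $q^s$ such that $(X,\|\cdot\|)$ is a Hilbert space. If $X/\langle\theta_q\rangle$ is finite-dimensional, then $(X,q)$ is linearly homeomorphic to $\langle\theta_q\rangle\times Z$, where $Z$ is a linear subspace of $X$ which is $T_1$ as a subspace of $(X,q)$ and is linearly homeomorphic to $X/\langle\theta_q\rangle$. In particular, $Z$ is linearly homeomorphic to a Euclidean space.
   Context: An asymmetric norm on a real vector space $X$ is a function $q:X\to[0,\infty)$ such that $q(ax)=aq(x)$ for all $a\ge 0$, $q(x+y)\le q(x)+q(y)$, and $q(x)=q(-x)=0$ implies $x=0$. The pair $(X,q)$ is an asymmetric normed space; its topology is generated by the open balls $B_q(x,\epsilon)=\{y\in X: q(y-x)<\epsilon\}$. The associated norm is $q^s(x)=\max\{q(x),q(-x)\}$, with open balls $B_{q^s}(x,\epsilon)$. The space $(X,q)$ is right-bounded if there exists $r>0$ such that $B_q(0,1)\subseteq B_{q^s}(0,r)+\theta_q$. Linear subspaces carry the restriction of $q$; products of asymmetric normed spaces $(X_1,q_1)$, $(X_2,q_2)$ carry the asymmetric norm $\max\{q_1(x_1),q_2(x_2)\}$ (which induces the product topology). For a linear subspace $Y$ of $X$, the quotient $X/Y$ carries the topology induced by the asymmetric seminorm $w_Y(x+Y)=\inf\{q(x+y):y\in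 Y\}$ (generated by the balls $\{u: w_Y(u-v)<\epsilon\}$), which coincides with the quotient topology. ''Linearly homeomorphic'' means that there is a linear bijection which is a homeomorphism. *)

(* Defs.v *)
From HB Require Import structures.
From mathcomp Require Import all_boot all_order all_algebra.
From mathcomp Require Import ring_quotient sesquilinear.
From mathcomp Require Import all_classical all_reals all_analysis.

Set Implicit Arguments.
Unset Strict Implicit.
Unset Printing Implicit Defensive.

Import Order.TTheory GRing.Theory Num.Theory.
Import Quotient.Exports.
Import numFieldNormedType.Exports.

Local Open Scope classical_set_scope.
Local Open Scope ring_scope.
Local Open Scope quotient_scope.

Section AsymmetricNorms.
Context {R : realType} {V : lmodType R}.
Implicit Types (q N M : V -> R) (x y : V).

Definition asym_norm q : Prop :=
  [/\ forall x, 0 <= q x,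
      forall (a : R) x, 0 <= a -> q (a *: x) = a * q x,
      forall x y, q (x + y) <= q x + q y
    & forall x, q x = 0 -> q (- x) = 0 -> x = 0].

Definition asym_ball q x (e : R) : set V := [set y | q (y - x) < e].

Definition assoc_norm q x : R := Num.max (q x) (q (- x)).

Definition theta q : set V := [set x | q x = 0].

Definition right_bounded q : Prop :=
  exists2 r : R, 0 < r &
    asym_ball q 0 1 `<=`
      [set y + z | y in asym_ball (assoc_norm q) 0 r & z in theta q].

Definition is_norm N : Prop :=
  [/\ forall x, 0 <= N x,
      forall (a : R) x, N (a *: x) = `|a| * N x,
      forall x y, N (x + y) <= N x + N y
    & forall x, N x = 0 -> x = 0].

Definition equivalent_norms N M : Prop :=
  exists c C : R, [/\ 0 < c, 0 < C & forall x, c * M x <= N x <= C * M x].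

Definition complete_norm N : Prop :=
  forall u : nat -> V,
    (forall e : R, 0 < e -> exists n0 : nat, forall m n : nat,
      (n0 <= m)%N -> (n0 <= n)%N -> N (u m - u n) < e) ->
    exists l : V, N (u n - l) @[n --> \oo] --> (0 : R).

Definition hilbert_norm N : Prop :=
  (exists B : {dot V for @idfun R}, forall x, N x = Num.sqrt (B x x)) /\
  complete_norm N.

End AsymmetricNorms.

(* The vector space V with the topology generated by the open balls of q; q is
   kept as a parameter of the type so that one space can carry several
   topologies. *)
Definition asym_space (R : realType) (V : lmodType R) (q : V -> R) : Type := V.

Section AsymSpace.
Context (R : realType) (V : lmodType R) (q : V -> R).

HB.instance Definition _ := GRing.Lmodule.on (asym_space q).

HB.instance Definition _ := isSubBaseTopological.Build (asym_space q)
  [set B : set V | exists x (e : R), 0 < e /\ B = asym_ball q x e] id.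

End AsymSpace.

Definition lin_homeomorphic (R : realType) (V W : preTopologicalLmodType R) :
    Prop :=
  exists (f : {linear V -> W}) (g : W -> V),
    [/\ cancel f g, cancel g f, continuous f & continuous g].

Definition finite_dimensional (R : realType) (V : lmodType R) : Prop :=
  exists n : nat, inhabited (Vector.axiom n V).

Section Span.
Context (R : realType) (V : lmodType R) (A : set V).

Definition lin_span : {pred V} := fun x =>
  `[< exists n (c : 'I_n -> R) (v : 'I_n -> V),
        (forall i, A (v i)) /\ x = \sum_i c i *: v i >].

Lemma lin_span_submod_closed : submod_closed lin_span.
Proof.
split.
  apply/asboolP; exists 0%N, (fun=> 0), (fun=> 0); split; first by case.
  by rewrite big_ord0.
move=> a x y /asboolP[m [c [v [Av ->]]]] /asboolP[n [d [w [Aw ->]]]].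
apply/asboolP; exists (m + n)%N.
exists (fun i => match fintype.split i with inl j => a * c j | inr j => d j end).
exists (fun i => match fintype.split i with inl j => v j | inr j => w j end).
split; first by move=> i; case: fintype.split.
rewrite big_split_ord/= scaler_sumr; congr +%R; apply: eq_bigr => i _.
  by rewrite (unsplitK (inl i)) scalerA.
by rewrite (unsplitK (inr i)).
Qed.

HB.instance Definition _ :=
  GRing.isSubmodClosed.Build R V lin_span lin_span_submod_closed.

End Span.

Section Subspaces.
Context (R : realType) (V : lmodType R) (Y : submodClosed V).

Record subspace_of : Type := SubspaceOf { sub_val : V; _ : sub_val \in Y }.

HB.instance Definition _ := [isSub for sub_val].
HB.instance Definition _ := [Choice of subspace_of by <:].
HB.instance Definition _ := [SubChoice_isSubLmodule of subspace_of by <:].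

End Subspaces.

Section Quotients.
Context (R : realType) (V : lmodType R) (Y : submodClosed V).

Let Y_zmod_closed : zmod_closed (Y : {pred V}) :=
  GRing.submod_closedB (submodClosedP Y).

Definition zmod_of_submod : zmodClosed V :=
  HB.pack_for (zmodClosed V) (Y : {pred V})
    (GRing.isZmodClosed.Build V (Y : {pred V}) Y_zmod_closed).

Definition quotient_space : Type := Quotient.quot zmod_of_submod.

HB.instance Definition _ := GRing.Zmodule.on quotient_space.
HB.instance Definition _ := EqQuotient.on quotient_space.

Lemma quot_eqP (x y : V) :
  reflect (\pi_quotient_space x = \pi_quotient_space y) (x - y \in Y).
Proof. by rewrite (Quotient.idealrBE zmod_of_submod); exact: eqP. Qed.

Lemma quot_piD (x y : V) :
  \pi_quotient_space (x + y) = \pi_quotient_space x + \pi_quotient_space y.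
Proof. exact: raddfD. Qed.

Definition quot_scale (a : R) (u : quotient_space) : quotient_space :=
  \pi_quotient_space (a *: repr u).

Lemma quot_scaleE (a : R) (x : V) :
  quot_scale a (\pi_quotient_space x) = \pi_quotient_space (a *: x).
Proof.
by apply/quot_eqP; rewrite -scalerBr rpredZ//; apply/quot_eqP; rewrite reprK.
Qed.

Fact quot_scaleA a b u : quot_scale a (quot_scale b u) = quot_scale (a * b) u.
Proof. by rewrite -[u]reprK (quot_scaleE b) !quot_scaleE scalerA. Qed.

Fact quot_scale1 : left_id 1 quot_scale.
Proof. by move=> u; rewrite -[u]reprK quot_scaleE scale1r. Qed.

Fact quot_scaleDr : right_distributive quot_scale +%R.
Proof.
move=> a u v; rewrite -[u]reprK -[v]reprK -quot_piD !quot_scaleE scalerDr.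
exact: quot_piD.
Qed.

Fact quot_scaleDl u : {morph quot_scale^~ u : a b / a + b}.
Proof. by move=> a b; rewrite -[u]reprK !quot_scaleE scalerDl quot_piD. Qed.

HB.instance Definition _ := GRing.Zmodule_isLmodule.Build R quotient_space
  quot_scaleA quot_scale1 quot_scaleDr quot_scaleDl.

End Quotients.

Definition quot_seminorm (R : realType) (V : lmodType R) (q : V -> R)
    (Y : submodClosed V) (u : quotient_space Y) : R :=
  inf [set q (repr u + y) | y in [set y | y \in Y]].

(* w_Y (x + Y) does not depend on the chosen representative x. *)
Lemma quot_seminormE (R : realType) (V : lmodType R) (q : V -> R)
    (Y : submodClosed V) (x : V) :
  quot_seminorm q (\pi_(quotient_space Y) x) =
  inf [set q (x + y) | y in [set y | y \in Y]].
Proof.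
rewrite /quot_seminorm.
have : repr (\pi_(quotient_space Y) x) - x \in Y by apply/quot_eqP; rewrite reprK.
move: (repr _) => x' x'xY; congr (inf _).
rewrite eqEsubset; split=> _ [y /= yY <-].
  exists (x' - x + y); first by rewrite /= rpredD.
  by rewrite addrA [x + _]addrC subrK.
exists (x - x' + y); first by rewrite /= rpredD// -opprB -scaleN1r rpredZ.
by rewrite addrA [x' + _]addrC subrK.
Qed.

Definition prod_norm (R : realType) (V W : lmodType R) (q : V -> R) (r : W -> R)
    (x : V * W) : R :=
  Num.max (q x.1) (r x.2).

Definition sub_norm (R : realType) (V : lmodType R) (q : V -> R)
    (Y : submodClosed V) (y : subspace_of Y) : R :=
  q (sub_val y).

Arguments asym_space {R V} q.
Arguments lin_span {R V} A.
Arguments quot_seminorm {R V} q Y u.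
Arguments sub_norm {R V} q Y y.

(* Main.v *)
(* Write q^s for assoc_norm q and Y for the span of theta q. Choosing a basis of
   X/Y and lifting it gives a linear map F : X -> R^n with kernel Y and a linear section s of F; the
   complement of Y is Z = s(R^n), and x |-> s (F x) is the projection onto Z
   along Y. Since Y is closed for the norm q^s and the unit sphere of R^n is
   compact, the q^s-distance to Y is bounded below on s(sphere), so that
   |F x| <= C q^s(x). Right-boundedness upgrades this to |F x| <= K q(x): if
   q(x) < 1 then x = b + t with q^s(b) < r and t in theta q, and F x = F b.
   Hence q and q^s are equivalent on Z, and all the maps in the statement are
   bounded linear bijections with bounded inverses. *)

Require Import Defs.
From HB Require Import structures.
From mathcomp Require Import all_boot all_order all_algebra.
From mathcomp Require Import finmap.
From mathcomp Require Import all_classical all_reals all_analysis.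

Set Implicit Arguments.
Unset Strict Implicit.
Unset Printing Implicit Defensive.

Import Order.TTheory GRing.Theory Num.Theory.
Import numFieldNormedType.Exports.

Local Open Scope classical_set_scope.
Local Open Scope ring_scope.

(** * Topologies with a neighbourhood base of one-sided balls *)

Definition gauges_topology {R : realType} {V : preTopologicalLmodType R}
    (p : V -> R) : Prop :=
  forall x (A : set V), nbhs x A <-> exists2 e, 0 < e & asym_ball p x e `<=` A.

(** Properties shared by q, q^s, their restrictions and products, and the quotient seminorm, which a
    priori may vanish on nonzero classes. *)
Definition subadditive_gauge {R : realType} {V : lmodType R} (p : V -> R) : Prop :=
  [/\ forall x, 0 <= p x, p 0 = 0 & forall x y, p (x + y) <= p x + p y].

Lemma asym_ball_open (R : realType) (V : lmodType R) (p : V -> R) x e :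
  0 < e -> open (asym_ball p x e : set (asym_space p)).
Proof.
move=> e0; exists [set asym_ball p x e]; last by rewrite bigcup_set1.
move=> _ ->; exists [fset (asym_ball p x e : set V)]%fset.
  by move=> A; rewrite in_fset1 => /eqP->; rewrite inE; exists x, e.
by rewrite set_fset1 bigcap_set1.
Qed.

(** The balls are given only as a subbase. By the triangle inequality, a ball of radius e about z
    that contains x also contains the ball of radius e - p(x - z) about x. *)
Lemma asym_space_gauge (R : realType) (V : lmodType R) (p : V -> R) :
  subadditive_gauge p -> gauges_topology (p : asym_space p -> R).
Proof.
move=> [_ p0 pD] x A; split=> [|[e e0 pA]]; last first.
  apply: filterS pA _; apply: open_nbhs_nbhs; split; first exact: asym_ball_open.
  by rewrite /asym_ball/= subrr p0.
rewrite nbhsE => -[_ [[D sD <-] [C DC Cx]] sA].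
have [I sI CE] := sD _ DC.
(* The sets containing a ball about x form a filter, so finite intersections reduce to a single
   subbasic ball. *)
pose G : set_system V := [set A | exists2 e, 0 < e & asym_ball p x e `<=` A].
have FG : Filter G.
  split; first by exists 1.
    move=> P Q [d d0 dP] [e e0 eQ]; exists (Num.min d e).
      by rewrite lt_min d0.
    by move=> y; rewrite /asym_ball/= lt_min => /andP[? ?]; split; [exact: dP|exact: eQ].
  by move=> P Q PQ [d d0 dP]; exists d => //; exact: subset_trans PQ.
suff : G C by apply: filterS => y Cy; apply: sA; exists C.
rewrite -CE; apply: filter_bigI => B BI.
have /sI := BI; rewrite inE => -[z [e [e0 BE]]].
have : B x by rewrite -CE in Cx; exact: Cx.
rewrite BE /asym_ball/= => xz; exists (e - p (x - z)); first by rewrite subr_gt0.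
move=> y; rewrite /asym_ball/= ltrBrDr; apply: le_lt_trans.
by rewrite -[y - z](subrKA x) pD.
Qed.

Lemma norm_gauge (R : realType) (V : normedModType R) :
  gauges_topology (fun x : V => `|x|).
Proof.
move=> x A; split=> [/nbhs_normP[e e0 eA]|[e e0 eA]]; last apply/nbhs_normP.
  by exists e => // y; rewrite /asym_ball/= distrC => /eA.
by exists e => // y; rewrite /ball_/= distrC => /eA.
Qed.

Lemma continuous_gauge (R : realType) (V W : preTopologicalLmodType R)
    (p : V -> R) (r : W -> R) (f : V -> W) (K : R) :
  gauges_topology p -> gauges_topology r ->
  (forall x, 0 <= p x) ->
  (forall x y, r (f x - f y) <= K * p (x - y)) -> continuous f.
Proof.
move=> hp hr p0 rf x A /hr[e e0 eA]; apply/hp.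
(* No sign is assumed on [K], hence the positive divisor. *)
have K0 : 0 < `|K| + 1 by rewrite ltr_wpDl.
exists (e / (`|K| + 1)); first by rewrite divr_gt0.
move=> y; rewrite /asym_ball/= ltr_pdivlMr// => ye; apply: eA.
rewrite /asym_ball/=; apply: le_lt_trans (rf _ _) _; apply: le_lt_trans ye.
rewrite mulrC ler_wpM2l//.
by rewrite (le_trans (ler_norm _))// lerDl.
Qed.

(** Common criterion for all the homeomorphisms below: [gauges_topology] treats [asym_space] and the
    normed space of row vectors alike. *)
Lemma lin_homeomorphic_gauge (R : realType) (V W : preTopologicalLmodType R)
    (p : V -> R) (r : W -> R) (f : {linear V -> W}) (g : W -> V) (K L : R) :
  gauges_topology p -> gauges_topology r ->
  (forall x, 0 <= p x) -> (forall x, 0 <= r x) ->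
  cancel f g -> cancel g f ->
  (forall x, r (f x) <= K * p x) -> (forall y, p (g y) <= L * r y) ->
  lin_homeomorphic V W.
Proof.
move=> hp hr p0 r0 fK gK rf pg; exists f, g; split=> //.
  by apply: (continuous_gauge hp hr (K := K)) => // x y; rewrite -linearB.
apply: (continuous_gauge hr hp (K := L)) => // x y.
(* [g] is a bare function; linearity of [f] transfers its bound to differences. *)
have <- : f (g x - g y) = x - y by rewrite linearB !gK.
by rewrite -[X in p X]fK.
Qed.

(** * Bounds for the coordinate map and its section *)

Section Bounds.
Context (R : realType) (X : lmodType R) (q : X -> R) (n : nat).
Context (F : {linear X -> 'rV[R]_n}) (s : {linear 'rV[R]_n -> X}).
Local Notation N := (assoc_norm q).
Local Notation Y := (lin_span (theta q)).
Hypotheses (hq : asym_norm q) (FK : cancel s F).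
Hypothesis kerF : forall x, (x \in Y) = (F x == 0).

Lemma asym_norm0 : q 0 = 0.
Proof. by case: hq => _ qZ _ _; rewrite -(scale0r 0) qZ// mul0r. Qed.

Lemma assoc_norm0 : N 0 = 0.
Proof. by rewrite /assoc_norm oppr0 asym_norm0 maxxx. Qed.

Lemma assoc_normN x : N (- x) = N x.
Proof. by rewrite /assoc_norm opprK maxC. Qed.

Lemma assoc_norm_ge x : q x <= N x.
Proof. by rewrite /assoc_norm le_max lexx. Qed.

Lemma assoc_normD x y : N (x + y) <= N x + N y.
Proof.
case: hq => _ _ qD _; rewrite /assoc_norm ge_max opprD.
by rewrite !(le_trans (qD _ _))// lerD// le_max lexx ?orbT.
Qed.

Lemma assoc_norm_ge0 x : 0 <= N x.
Proof. by case: hq => q0 _ _ _; apply: le_trans (assoc_norm_ge x). Qed.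

Lemma assoc_normZ a x : N (a *: x) = `|a| * N x.
Proof.
case: hq => _ qZ _ _.
wlog a0 : a / 0 <= a => [wl|]; last by rewrite /assoc_norm -scalerN !qZ// maxr_pMr// ger0_norm.
have [/wl//|/ltW a0] := leP 0 a.
by rewrite -normrN -wl ?oppr_ge0// scaleNr assoc_normN.
Qed.

(** Expand v in the standard basis: each coordinate is at most the sup norm of v, so the sum of the
    q^s-values of the lifted basis vectors serves as constant. *)
Lemma section_bounded : exists2 D, 0 <= D & forall v, N (s v) <= D * `|v|.
Proof.
exists (\sum_i N (s (delta_mx 0 i))); first by apply: sumr_ge0 => i _; exact: assoc_norm_ge0.
move=> v; rewrite {1}[v]row_sum_delta linear_sum mulr_suml.
apply: (@le_trans _ _ (\sum_i N (s (v 0 i *: delta_mx 0 i)))).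
  elim/big_ind2 : _ => //; first by rewrite assoc_norm0.
  by move=> x a y b xa yb; apply: le_trans (assoc_normD _ _) (lerD _ _).
apply: ler_sum => i _; rewrite linearZ/= assoc_normZ mulrC ler_wpM2l ?assoc_norm_ge0//.
rewrite [leRHS]/Num.Def.normr/= mx_normrE.
by apply: (le_trans _ (le_bigmax _ _ (0, i))).
Qed.

Lemma coordinates_assoc_bounded :
  closed ([set x | x \in Y] : set (asym_space N)) ->
  exists2 C, 0 <= C & forall x, `|F x| <= C * N x.
Proof.
move=> Ycl; have [D D0 sD] := section_bounded.
have ND := assoc_normD; have NN := assoc_normN; have NZ := assoc_normZ.
have hN : gauges_topology (N : asym_space N -> R).
  by apply: asym_space_gauge; split=> //; [exact: assoc_norm_ge0|exact: assoc_norm0].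
pose S : set 'rV[R]_n := [set v | `|v| = 1].
have Sc : compact S.
  apply: bounded_closed_compact.
    by exists 1; split; rewrite ?num_real// => M M1 v /= ->; exact: ltW.
  have -> : S = (fun v => `|v|) @^-1` [set 1 : R] by [].
  apply: closed_comp; last exact: closed_eq.
  by move=> v _; exact: norm_continuous.
(* The lower bound is proved near each point of the sphere; compactness makes it uniform. *)
have : \forall e \near 0^'+, S `<=` [set v | forall x, F x = v -> e <= N x].
  move/compact_near_coveringP : Sc; apply => v /= v1.
  have : (~` [set x | x \in Y] : set (asym_space N)) (s v).
    rewrite /= kerF FK => /eqP v0.
    by move: v1; rewrite /S/= v0 normr0 => /eqP; rewrite eq_sym oner_eq0.
  (* Closedness of Y gives a ball of radius d about s v that misses Y. If F x = w, then s w - x lies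
     in Y, so w close to v and q^s(x) < d/2 would contradict this. *)
  move=> sv; have /hN[d d0 dY] := open_nbhs_nbhs (conj (closed_openC Ycl) sv).
  have d20 : 0 < d / 2 by rewrite divr_gt0.
  exists ([set w | D * `|w - v| < d / 2], [set e | e < d / 2]); last first.
    move=> [w e]/= [Dw ed] x Fx; rewrite leNgt; apply/negP => xe.
    apply: (dY (s w - x)); last by rewrite /= kerF linearB FK Fx subrr.
    rewrite /asym_ball/= addrAC -linearB (splitr d).
    apply: le_lt_trans (ND _ _) _; rewrite NN ltrD// ?(lt_trans xe)//.
    exact: le_lt_trans (sD _) Dw.
  split; last exact: nbhs_right_lt.
  apply/norm_gauge; exists (d / 2 / (D + 1)).
    by rewrite divr_gt0// ltr_wpDl.
  move=> w /=; rewrite /asym_ball/= ltr_pdivlMr ?ltr_wpDl//.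
  by apply: le_lt_trans; rewrite mulrC ler_wpM2l// lerDl.
move=> [e/= e0 eS].
(* The bound is known for positive values strictly below e; e/2 is one of them. *)
have {}eS x : `|F x| = 1 -> e / 2 <= N x.
  move=> Fx; apply: (eS (e / 2) _ _ (F x)) => //=; last by rewrite divr_gt0.
  by rewrite sub0r normrN gtr0_norm ?divr_gt0// ltr_pdivrMr// mulr_natr mulr2n ltrDr.
exists (e / 2)^-1; first by rewrite invr_ge0 ltW// divr_gt0.
move=> x; have [->|Fx0] := eqVneq (F x) 0.
  by rewrite normr0 mulr_ge0 ?assoc_norm_ge0// invr_ge0 ltW// divr_gt0.
have F0 : 0 < `|F x| by rewrite normr_gt0.
have := eS (`|F x|^-1 *: x); rewrite linearZ normrZ normfV normr_id.
rewrite mulVf ?gt_eqF// => /(_ erefl).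
by rewrite NZ normfV normr_id !ler_pdivlMl ?divr_gt0// mulrC.
Qed.

Lemma coordinates_bounded : right_bounded q ->
  closed ([set x | x \in Y] : set (asym_space N)) ->
  exists2 K, 0 <= K & forall x, `|F x| <= K * q x.
Proof.
move=> [r r0 rb] /coordinates_assoc_bounded[C C0 FC].
case: hq => q0 qZ qD qs.
have Ft t : theta q t -> F t = 0.
  move=> tt; apply/eqP; rewrite -kerF; apply/asboolP.
  by exists 1%N, (fun=> 1), (fun=> t); split=> //; rewrite big_ord1 scale1r.
have Fle1 x : q x < 1 -> `|F x| <= C * r.
  move=> qx; have [] := rb x; first by rewrite /asym_ball/= subr0.
  move=> b; rewrite /asym_ball/= subr0 => br [t /Ft t0 <-].
  by rewrite linearD t0 addr0 (le_trans (FC _))// ler_wpM2l// ltW.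
(* Right-boundedness concerns the open unit ball, so x is rescaled to q-value 1/2, whence the factor
   2. Vectors with q(x) = 0 are treated apart: F kills them. *)
exists (C * r * 2); first by rewrite !mulr_ge0// ltW.
move=> x; have := q0 x; rewrite le_eqVlt => /predU1P[qx|qx].
  by rewrite -qx mulr0 Ft ?normr0.
have q2 : 0 < 2 * q x by rewrite mulr_gt0.
have := Fle1 ((2 * q x)^-1 *: x).
have q2V : 0 <= (2 * q x)^-1 by rewrite invr_ge0 ltW.
rewrite qZ// ltr_pdivrMl// mulr1 ltr_pMl// ltr1n => /(_ isT).
rewrite linearZ normrZ ger0_norm// ler_pdivrMl//.
by rewrite [2 * q x * _]mulrC mulrA.
Qed.

End Bounds.

(** * Gauges on subspaces, products and quotients *)

Lemma subadditive_gauge_sub (R : realType) (V : lmodType R) (p : V -> R)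
    (Y : submodClosed V) :
  subadditive_gauge p -> subadditive_gauge (sub_norm p Y).
Proof. by move=> [p_ge0 p0 pD]; split=> [x||x y]; [exact: p_ge0|exact: p0|exact: pD]. Qed.

Lemma subadditive_gauge_prod (R : realType) (V W : lmodType R)
    (p : V -> R) (r : W -> R) :
  subadditive_gauge p -> subadditive_gauge r -> subadditive_gauge (prod_norm p r).
Proof.
move=> [p_ge0 p0 pD] [r_ge0 r0 rD]; split=> [x||x y]; rewrite /prod_norm.
- by rewrite le_max p_ge0.
- by rewrite /= p0 r0 maxxx.
- by rewrite ge_max (le_trans (pD _ _)) ?(le_trans (rD _ _))// lerD// le_max lexx ?orbT.
Qed.

Section QuotientSeminorm.
Context (R : realType) (V : lmodType R) (p : V -> R) (Y : submodClosed V).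
Hypothesis hp : subadditive_gauge p.

Let p_ge0 x : 0 <= p x. Proof. by case: hp. Qed.

Lemma quot_seminorm_le x y :
  y \in Y -> quot_seminorm p Y (\pi_(quotient_space Y)%qT x) <= p (x + y).
Proof.
move=> yY; rewrite quot_seminormE; apply: ge_inf; last by exists y.
by exists 0 => _ [z _ <-].
Qed.

Lemma le_quot_seminorm c x :
  (forall y, y \in Y -> c <= p (x + y)) ->
  c <= quot_seminorm p Y (\pi_(quotient_space Y)%qT x).
Proof.
move=> cp; rewrite quot_seminormE; apply: lb_le_inf.
  by exists (p (x + 0)); exists 0 => //=; exact: rpred0.
by move=> _ [y yY <-]; exact: cp.
Qed.

Lemma subadditive_gauge_quot : subadditive_gauge (quot_seminorm p Y).
Proof.
case: hp => _ p0 pD.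
have w_ge0 u : 0 <= quot_seminorm p Y u.
  by rewrite -[u]reprK; exact: le_quot_seminorm.
split=> // [|u v].
  apply/eqP; rewrite eq_le w_ge0 andbT.
  have := quot_seminorm_le 0 (rpred0 Y); rewrite addr0 p0.
  by rewrite (raddf0 (\pi_(quotient_space Y)%qT)).
rewrite -[u]reprK -[v]reprK -quot_piD.
move: (repr u) (repr v) => x y.
(* The two infima are taken one after the other; z + t in Y is the competitor for the class of x +
   y. *)
rewrite -lerBlDr; apply: le_quot_seminorm => z zY.
rewrite lerBlDr -lerBlDl; apply: le_quot_seminorm => t tY.
rewrite lerBlDl (le_trans (quot_seminorm_le _ (rpredD zY tY)))//.
by rewrite addrACA pD.
Qed.

End QuotientSeminorm.

(** * Complements of a subspace of finite codimension *)

Lemma finite_codim_coordinates (R : realType) (V : lmodType R)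
    (Y : submodClosed V) :
  finite_dimensional (quotient_space Y) ->
  exists n (F : {linear V -> 'rV[R]_n}) (s : {linear 'rV[R]_n -> V}),
    cancel s F /\ forall x, (x \in Y) = (F x == 0).
Proof.
move=> [n [[phi philin [psi phiK psiK]]]].
pose F0 x := phi (\pi_(quotient_space Y)%qT x).
have F0lin : linear F0.
  by move=> a x y; rewrite /F0 quot_piD -quot_scaleE philin.
pose F : {linear V -> 'rV[R]_n} :=
  HB.pack F0 (GRing.isLinear.Build _ _ _ _ F0 F0lin).
(* Only the classes of the basis vectors are lifted by [repr], which need not be linear; [s0]
   extends these choices linearly. *)
pose s0 (v : 'rV[R]_n) := \sum_i v 0 i *: repr (psi (delta_mx 0 i)).
have s0lin : linear s0.
  move=> a v w; rewrite /s0 scaler_sumr -big_split/=; apply: eq_bigr => i _.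
  by rewrite !mxE scalerDl scalerA.
pose s : {linear 'rV[R]_n -> V} :=
  HB.pack s0 (GRing.isLinear.Build _ _ _ _ s0 s0lin).
exists n, F, s; split=> [v|x].
  rewrite -[s v]/(s0 v) /s0 linear_sum [RHS]row_sum_delta; apply: eq_bigr => i _.
  by rewrite linearZ/= /F0 reprK psiK.
have phi0 : phi 0 = 0.
  by have := philin (-1) 0 0; rewrite scaler0 addr0 scaleN1r addNr.
apply/idP/eqP => [xY|Fx].
  rewrite /= /F0 -phi0; congr phi.
  rewrite -(raddf0 (\pi_(quotient_space Y)%qT)).
  by apply/quot_eqP; rewrite subr0.
rewrite -[x]subr0; apply/quot_eqP; rewrite (raddf0 (\pi_(quotient_space Y)%qT)).
by apply: (can_inj phiK); rewrite phi0.
Qed.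

Section Complement.
Context (R : realType) (X : lmodType R) (Y : submodClosed X) (n : nat).
Context (F : {linear X -> 'rV[R]_n}) (s : {linear 'rV[R]_n -> X}).
Hypotheses (FK : cancel s F) (kerF : forall x, (x \in Y) = (F x == 0)).

Local Notation Z := (lin_span (range s)).

(** s F fixes the range of s, hence its span. The span is thus the range itself, presented as a
    [submodClosed]. *)
Lemma complementP x : reflect (s (F x) = x) (x \in Z).
Proof.
apply: (iffP idP) => [/asboolP[m [c [v [sv ->]]]]|<-].
  rewrite !linear_sum; apply: eq_bigr => i _; rewrite !linearZ/=.
  by have [w _ <-] := sv i; rewrite FK.
apply/asboolP; exists 1%N, (fun=> 1), (fun=> s (F x)).
by split=> [_|]; [exists (F x)|rewrite big_ord1 scale1r].
Qed.

Lemma mem_complement v : s v \in Z.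
Proof. by apply/complementP; rewrite FK. Qed.

Lemma mem_kernel x : x - s (F x) \in Y.
Proof. by rewrite kerF linearB FK subrr. Qed.

Definition complement_decomp x : subspace_of Y * subspace_of Z :=
  (SubspaceOf (mem_kernel x), SubspaceOf (mem_complement (F x))).

Lemma complement_decomp_linear : linear complement_decomp.
Proof.
move=> a x y; congr pair; apply: val_inj; rewrite /= !linearP//=.
by rewrite addrACA -scalerDr.
Qed.

Lemma complement_decompK : cancel complement_decomp (fun u => val u.1 + val u.2).
Proof. by move=> x /=; rewrite subrK. Qed.

Lemma complement_decompVK : cancel (fun u => val u.1 + val u.2) complement_decomp.
Proof.
move=> [[y yY] [z zZ]]; have /complementP sFz := zZ.
have := yY; rewrite kerF => /eqP Fy.
by congr pair; apply: val_inj; rewrite /= linearD Fy add0r sFz ?addrK.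
Qed.

End Complement.

Theorem corollary4p8 (R : realType) (X : lmodType R) (q : X -> R)
  (hq : asym_norm q) (hrb : right_bounded q)
  (hclosed : closed ([set x | x \in lin_span (theta q)]
                       : set (asym_space (assoc_norm q))))
  (hhilb : exists N : X -> R,
     [/\ is_norm N, equivalent_norms N (assoc_norm q) & hilbert_norm N])
  (hfin : finite_dimensional (quotient_space (lin_span (theta q)))) :
  exists Z : submodClosed X,
    [/\ lin_homeomorphic
          (asym_space q)
          (asym_space (prod_norm (sub_norm q (lin_span (theta q)))
                                 (sub_norm q Z))),
        accessible_space (asym_space (sub_norm q Z)),
        lin_homeomorphic
          (asym_space (sub_norm q Z))
          (asym_space (quot_seminorm q (lin_span (theta q))))
      & exists n : nat,
          lin_homeomorphic (asym_space (sub_norm q Z)) ('rV[R]_n : normedModType R)].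
Proof.
have [q_ge0 qZ qD q_sep] := hq.
have [n [F [s [FK kerF]]]] := finite_codim_coordinates hfin.
have [D D0 sD] := section_bounded s hq.
have [K K0 FKq] := coordinates_bounded hq FK kerF hrb hclosed.
have qsD v : q (s v) <= D * `|v| := le_trans (assoc_norm_ge q _) (sD v).
(* The projection onto Z is bounded from q to the symmetric q^s, which controls both s (F x) and its
   opposite. *)
have NsF x : assoc_norm q (s (F x)) <= D * K * q x.
  by rewrite (le_trans (sD _))// -mulrA ler_wpM2l.
set Y := lin_span (theta q).
pose Z : submodClosed X := lin_span (range s).
have sFZ z : z \in Z -> s (F z) = z by move/(complementP FK).
have gq : subadditive_gauge q by split=> //; exact: asym_norm0.
have gsub W : subadditive_gauge (sub_norm q W) by exact: subadditive_gauge_sub.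
have gN := @norm_gauge R ('rV[R]_n : normedModType R).
exists Z; split.
- have gp := subadditive_gauge_prod (gsub Y) (gsub Z).
  pose f : {linear asym_space q -> asym_space (prod_norm (sub_norm q Y) (sub_norm q Z))} :=
    HB.pack (complement_decomp FK kerF)
      (GRing.isLinear.Build _ _ _ _ _ (complement_decomp_linear FK kerF)).
  (* 1 + D K comes from q(x - s (F x)) <= q(x) + q(- s (F x)), and 2 from bounding a sum by twice
     the maximum. *)
  apply: (@lin_homeomorphic_gauge _ _ _ _ _ f (fun u => val u.1 + val u.2)
    (1 + D * K) 2 (asym_space_gauge gq) (asym_space_gauge gp)).
  + by [].
  + by case: gp.
  + exact: complement_decompK.
  + exact: complement_decompVK.
  + move=> x; rewrite /prod_norm /sub_norm/= ge_max; apply/andP; split.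
      rewrite (le_trans (qD _ _))// mulrDl mul1r lerD//.
      by rewrite (le_trans _ (NsF x))// -[leRHS]assoc_normN assoc_norm_ge.
    rewrite (le_trans (assoc_norm_ge _ _))// (le_trans (NsF x))//.
    by rewrite mulrDl mul1r lerDr.
  + move=> [y z]; rewrite /prod_norm /sub_norm/= (le_trans (qD _ _))//.
    by rewrite mulr_natl mulr2n lerD// le_max lexx ?orbT.
- move=> x y xy.
  (* On Z the projection is the identity, so q(y - x) = 0 forces q^s(y - x) = 0. The ball about x of
     radius q(y - x) then excludes y. *)
  have yx0 : 0 < sub_norm q Z (y - x).
    rewrite lt_neqAle eq_sym q_ge0 andbT; apply: contra xy => /eqP yx0.
    have Nyx : assoc_norm q (val (y - x)) <= 0.
      by rewrite -(sFZ _ (valP (y - x))) (le_trans (NsF _))// -/(sub_norm q Z _) yx0 mulr0.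
    apply/eqP/esym/subr0_eq/val_inj; apply: q_sep => //.
    apply/eqP; rewrite eq_le q_ge0 andbT (le_trans _ Nyx)//.
    by rewrite -assoc_normN assoc_norm_ge.
  exists (asym_ball (sub_norm q Z) x (sub_norm q Z (y - x))).
  rewrite !inE; split; first exact: asym_ball_open.
    by rewrite /asym_ball/= subrr; case: (gsub Z) => _ ->.
  by rewrite /asym_ball/= ltxx.
- have gw := subadditive_gauge_quot Y gq.
  pose f0 (z : subspace_of Z) := (\pi_(quotient_space Y)%qT (val z)).
  have f0lin : linear f0.
    by move=> a x y; rewrite /f0 linearP quot_piD -quot_scaleE.
  pose f : {linear asym_space (sub_norm q Z) -> asym_space (quot_seminorm q Y)} :=
    HB.pack f0 (GRing.isLinear.Build _ _ _ _ _ f0lin).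
  pose g (u : quotient_space Y) : subspace_of Z :=
    SubspaceOf (mem_complement FK (F (repr u))).
  (* F vanishes on Y, so [g] does not depend on the representative. *)
  have Frepr x : F (repr (\pi_(quotient_space Y)%qT x)) = F x.
    apply/subr0_eq/eqP; rewrite -linearB -kerF.
    by apply/quot_eqP; rewrite reprK.
  apply: (@lin_homeomorphic_gauge _ _ _ _ _ f g 1 (D * K + 1)
    (asym_space_gauge (gsub Z)) (asym_space_gauge gw)).
  + by case: (gsub Z).
  + by case: gw.
  + by move=> z; apply: val_inj; rewrite /= Frepr sFZ// (valP z).
  + move=> u; rewrite /= /f0/= -[RHS]reprK; apply/quot_eqP.
    by rewrite kerF linearB FK subrr.
  + move=> z; rewrite mul1r.
    by have := quot_seminorm_le gq (val z) (rpred0 Y); rewrite addr0.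
  + move=> u; rewrite -[u]reprK; move: (repr u) => x.
    rewrite /sub_norm/= Frepr.
    have DK : 0 < D * K + 1 by rewrite ltr_wpDl// mulr_ge0.
    (* For y in Y, F (x + y) = F x, so the projection bound holds at every point of the coset and
       passes to the infimum; the added 1 keeps the divisor positive. *)
    rewrite -ler_pdivrMl//; apply: le_quot_seminorm => y; rewrite kerF => /eqP Fy.
    rewrite ler_pdivrMl// (le_trans (assoc_norm_ge _ _))//.
    have := NsF (x + y); rewrite linearD Fy addr0 => /le_trans; apply.
    by rewrite mulrDl mul1r lerDl.
(* F restricted to Z has inverse s, and the bounds [K] and [D] are those already found. *)
- pose f0 (z : subspace_of Z) : 'rV[R]_n := F (val z).
  have f0lin : linear f0 by move=> a x y; rewrite /f0 !linearP.
  pose f : {linear asym_space (sub_norm q Z) -> ('rV[R]_n : normedModType R)} :=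
    HB.pack f0 (GRing.isLinear.Build _ _ _ _ _ f0lin).
  exists n; apply: (@lin_homeomorphic_gauge R (asym_space (sub_norm q Z))
    ('rV[R]_n : normedModType R) _ _ f
    (fun v => SubspaceOf (mem_complement FK v)) K D (asym_space_gauge (gsub Z)) gN).
  + by case: (gsub Z).
  + by [].
  + by move=> z; apply: val_inj; rewrite /= sFZ// (valP z).
  + by move=> v; rewrite /= /f0/= FK.
  + by move=> z; exact: FKq.
  + by move=> v; exact: qsD.
Qed.
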